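(* Let $\hat V(\xi)=\xi^\top P\xi+2q^\top\xi+r$ with $P\in\mathbb S^2_{++}$, $q\in\mathbb R^2$, $r\in\mathbb R$. Given $\delta>0$, let $\Omega_\delta=\{\xi\in\mathbb R^2:\hat V(\xi)\le\delta\}$ and let $$\sigma_\delta(\theta_{\mathrm{re}})=\max_{i\in\{1,\dots,\mathrm p\}}\sigma_{\delta,i}(\theta_{\mathrm{re}}),\qquad \sigma_{\delta,i}(\theta_{\mathrm{re}})=\max\{\hat V_i^+(\xi,\theta_{\mathrm{re}}):\ \xi\in\mathcal R_i(\theta_{\mathrm{re}})\cap\Omega_\delta\}.$$ If $\max_{\theta_{\mathrm{re}}\in[0,2\pi)}\sigma_\delta(\theta_{\mathrm{re}})\le\delta$, then the set $\Omega_\delta$ is positively invariant for the closed loop under $\mathbf k$, i.e. $$\hat V\big(f(\xi,\theta_{\mathrm{re}},\mathbf k(\xi,\theta_{\mathrm{re}}))\big)\le\delta\qquad\text{for all }\xi\in\Omega_\delta\text{ and all }\theta_{\mathrm{re}}\in[0,2\pi).$$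
   Context: Setting (discretized error dynamics of a three-phase permanent-magnet synchronous motor). Real constants: $L_d,L_q>0$ (inductances), $R$ (stator resistance), $\Lambda_{PM}$ (flux linkage), $\omega_{\mathrm{re}}$ (electrical speed), $T_s>0$ (sampling time), $V_{bus}>0$ (bus voltage), an integer $N_{level}\ge 2$, a discount factor $\gamma\in(0,1)$, and a desired current $i_{dq}^{r\star}\in\mathbb R^2$. Define $$A=\begin{bmatrix}-R/L_d & \omega_{\mathrm{re}}L_q/L_d\\ -\omega_{\mathrm{re}}L_d/L_q & -R/L_q\end{bmatrix},\quad B=\begin{bmatrix}L_d^{-1}&0\\0&L_q^{-1}\end{bmatrix},\quad E=\begin{bmatrix}0\\ \Lambda_{PM}\end{bmatrix},$$ $A_d=T_sA+I$, $B_d=T_sB$, $E_d=T_sE$, $\bar x_e=(A_d-I)i_{dq}^{r\star}+E_d$. Rotation matrix: $\mathsf R(\theta)=\begin{bmatrix}\cos\theta&\sin\theta\\-\sin\theta&\cos\theta\end{bmatrix}$. Finite control set: $\mathbb U=\{\tfrac{V_{bus}}{N_{level}-1}T_C s:\ s\in\{0,1,\dots,N_{level}-1\}^3\}\subset\mathbb R^2$ with $T_C=\frac13\begin{bmatrix}2&-1&-1\\0&\sqrt3&-\sqrt3\end{bmatrix}$; enumerate its (distinct) elements as $\mathbb U=\{u_1,\dots,u_{\mathrm p}\}$. Error dynamics map: $f(\xi,\theta_{\mathrm{re}},u)=A_d\xi+B_d\mathsf R(\theta_{\mathrm{re}})u+\bar x_e$. Stage cost: $\ell(\xi)=\|\xi\|_2^2$.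 Controller (horizon-one MPC): $\mathbf k(\xi,\theta_{\mathrm{re}})\in\arg\min_{u\in\mathbb U}\ \ell(\xi)+\gamma\hat V(f(\xi,\theta_{\mathrm{re}},u))$, ties being broken arbitrarily. With $h_i(\theta_{\mathrm{re}})=B_d\mathsf R(\theta_{\mathrm{re}})u_i+\bar x_e$, $\tilde h_{ij}=h_i-h_j$ and $\|x\|_P^2=x^\top Px$, define $$a_{ij}(\theta_{\mathrm{re}})=2A_d^\top P\tilde h_{ij}(\theta_{\mathrm{re}}),\qquad b_{ij}(\theta_{\mathrm{re}})=\|h_i(\theta_{\mathrm{re}})\|_P^2-\|h_j(\theta_{\mathrm{re}})\|_P^2+2q^\top\tilde h_{ij}(\theta_{\mathrm{re}}),$$ $$\mathcal R_i(\theta_{\mathrm{re}})=\{\xi\in\mathbb R^2:\ a_{ij}(\theta_{\mathrm{re}})^\top\xi\le -b_{ij}(\theta_{\mathrm{re}})\ \ \forall j\in\{1,\dots,\mathrm p\}\},$$ and $\hat V_i^+(\xi,\theta_{\mathrm{re}})=\xi^\top\breve P\xi+2\breve q_i(\theta_{\mathrm{re}})^\top\xi+\breve r_i(\theta_{\mathrm{re}})$, where $\breve P=A_d^\top PA_d$, $\breve q_i(\theta_{\mathrm{re}})=A_d^\top Ph_i(\theta_{\mathrm{re}})+A_d^\top q$, $\breve r_i(\theta_{\mathrm{re}})=h_i(\theta_{\mathrm{re}})^\top Ph_i(\theta_{\mathrm{re}})+2q^\top h_i(\theta_{\mathrm{re}})+r$. The maximum over an empty set is taken to be $-\infty$. $\mathbb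 S^2_{++}$ is the set of $2\times2$ real symmetric positive definite matrices. *)

(* Defs.v *)
From mathcomp Require Export all_boot all_order all_algebra.
From mathcomp Require Export classical_sets functions reals ereal trigo.
Export Order.TTheory GRing.Theory Num.Theory.

Set Implicit Arguments.
Unset Strict Implicit.
Unset Printing Implicit Defensive.

Local Open Scope classical_set_scope.
Local Open Scope ring_scope.

Definition mx_of_rows (R : realType) m n (s : seq (seq R)) : 'M[R]_(m, n) :=
  \matrix_(i, j) (nth [::] s i)`_j.

Definition dotv (R : realType) n (x y : 'cV[R]_n) : R := (x^T *m y) 0 0.

(* $\|x\|_P^2 = x^\top P x$ *)
Definition normP2 (R : realType) n (P : 'M[R]_n) (x : 'cV[R]_n) : R :=
  (x^T *m P *m x) 0 0.

(* The norm that MathComp-Analysis puts on matrices is the max norm. *)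
Definition norm2 (R : realType) n (x : 'cV[R]_n) : R :=
  Num.sqrt (\sum_i (x i 0) ^+ 2).

Definition sym_posdef (R : realType) n (P : 'M[R]_n) : Prop :=
  P^T = P /\ forall x : 'cV[R]_n, x != 0 -> 0 < normP2 P x.

Definition arg_min_set (R : realType) (T : Type) (U : set T) (J : T -> R) :
  set T := [set u | U u /\ forall v, U v -> J u <= J v].

(* The maximum in the extended reals as a total operation: it is the greatest
   element whenever there is one (emaxE) and $-\infty$ on the empty set
   (emax0). Taking the supremum avoids assuming that the maximum is attained. *)
Definition emax (R : realType) (S : set (\bar R)) : \bar R := ereal_sup S.

Lemma emaxE (R : realType) (S : set (\bar R)) (m : \bar R) :
  S m -> ubound S m -> emax S = m.
Proof.
move=> Sm ubm; apply/eqP; rewrite eq_le; apply/andP; split.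
  exact: ge_ereal_sup.
exact: ereal_sup_ubound.
Qed.

Lemma emax0 (R : realType) : emax (set0 : set (\bar R)) = -oo%E.
Proof. exact: ereal_sup0. Qed.

Record pmsm (R : realType) := Pmsm {
  Ld : R;            (* d-axis inductance *)
  Lq : R;            (* q-axis inductance *)
  Rstator : R;       (* stator resistance *)
  LambdaPM : R;      (* flux linkage of the permanent magnet *)
  omega_re : R;      (* electrical speed *)
  Ts : R;            (* sampling time *)
  Vbus : R;          (* bus voltage *)
  Nlevel : nat;      (* number of inverter levels *)
  i_ref : 'cV[R]_2   (* desired current in the dq frame *)
}.

Definition Amx (R : realType) (D : pmsm R) : 'M[R]_2 := mx_of_rows 2 2
  [:: [:: - (Rstator D / Ld D); omega_re D * Lq D / Ld D];
      [:: - (omega_re D * Ld D / Lq D); - (Rstator D / Lq D)]].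

Definition Bmx (R : realType) (D : pmsm R) : 'M[R]_2 := mx_of_rows 2 2
  [:: [:: (Ld D)^-1; 0];
      [:: 0; (Lq D)^-1]].

Definition Emx (R : realType) (D : pmsm R) : 'cV[R]_2 := mx_of_rows 2 1
  [:: [:: 0]; [:: LambdaPM D]].

Definition Ad (R : realType) (D : pmsm R) : 'M[R]_2 := Ts D *: Amx D + 1%:M.

Definition Bd (R : realType) (D : pmsm R) : 'M[R]_2 := Ts D *: Bmx D.

Definition Ed (R : realType) (D : pmsm R) : 'cV[R]_2 := Ts D *: Emx D.

Definition xbar_e (R : realType) (D : pmsm R) : 'cV[R]_2 :=
  (Ad D - 1%:M) *m i_ref D + Ed D.

Definition rotmx (R : realType) (theta : R) : 'M[R]_2 := mx_of_rows 2 2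
  [:: [:: cos theta; sin theta];
      [:: - sin theta; cos theta]].

Definition TC (R : realType) : 'M[R]_(2, 3) := 3^-1 *: mx_of_rows 2 3
  [:: [:: 2; -1; -1];
      [:: 0; Num.sqrt 3; - Num.sqrt 3]].

Definition control_set (R : realType) (D : pmsm R) : set 'cV[R]_2 :=
  [set (Vbus D / ((Nlevel D)%:R - 1)) *: (TC R *m \col_j (s j)%:R)
    | s in [set: {ffun 'I_3 -> 'I_(Nlevel D)}]].

Definition err_dyn (R : realType) (D : pmsm R)
    (xi : 'cV[R]_2) (theta : R) (u : 'cV[R]_2) : 'cV[R]_2 :=
  Ad D *m xi + Bd D *m rotmx theta *m u + xbar_e D.

Definition stage_cost (R : realType) (xi : 'cV[R]_2) : R := norm2 xi ^+ 2.

Definition Vhat (R : realType) (P : 'M[R]_2) (q : 'cV[R]_2) (r : R)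
    (xi : 'cV[R]_2) : R :=
  normP2 P xi + 2 * dotv q xi + r.

(* k is any selection from the minimizers: ties are broken arbitrarily. *)
Definition horizon_one_mpc (R : realType) (D : pmsm R) (gamma : R)
    (V : 'cV[R]_2 -> R) (k : 'cV[R]_2 -> R -> 'cV[R]_2) : Prop :=
  forall (xi : 'cV[R]_2) (theta : R),
    arg_min_set (control_set D)
      (fun u => stage_cost xi + gamma * V (err_dyn D xi theta u)) (k xi theta).

Definition enumerates (R : realType) (U : set 'cV[R]_2) (p : nat)
    (u : 'I_p -> 'cV[R]_2) : Prop :=
  injective u /\ range u = U.

Definition h_ (R : realType) (D : pmsm R) p (u : 'I_p -> 'cV[R]_2)
    (i : 'I_p) (theta : R) : 'cV[R]_2 :=
  Bd D *m rotmx theta *m u i + xbar_e D.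

Definition htilde (R : realType) (D : pmsm R) p (u : 'I_p -> 'cV[R]_2)
    (i j : 'I_p) (theta : R) : 'cV[R]_2 :=
  h_ D u i theta - h_ D u j theta.

Definition a_ (R : realType) (D : pmsm R) (P : 'M[R]_2) p
    (u : 'I_p -> 'cV[R]_2) (i j : 'I_p) (theta : R) : 'cV[R]_2 :=
  2 *: ((Ad D)^T *m P *m htilde D u i j theta).

Definition b_ (R : realType) (D : pmsm R) (P : 'M[R]_2) (q : 'cV[R]_2) p
    (u : 'I_p -> 'cV[R]_2) (i j : 'I_p) (theta : R) : R :=
  normP2 P (h_ D u i theta) - normP2 P (h_ D u j theta)
    + 2 * dotv q (htilde D u i j theta).

Definition region (R : realType) (D : pmsm R) (P : 'M[R]_2) (q : 'cV[R]_2) p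
    (u : 'I_p -> 'cV[R]_2) (i : 'I_p) (theta : R) : set 'cV[R]_2 :=
  [set xi | forall j : 'I_p,
    dotv (a_ D P u i j theta) xi <= - b_ D P q u i j theta].

Definition P_breve (R : realType) (D : pmsm R) (P : 'M[R]_2) : 'M[R]_2 :=
  (Ad D)^T *m P *m Ad D.

Definition q_breve (R : realType) (D : pmsm R) (P : 'M[R]_2) (q : 'cV[R]_2) p
    (u : 'I_p -> 'cV[R]_2) (i : 'I_p) (theta : R) : 'cV[R]_2 :=
  (Ad D)^T *m P *m h_ D u i theta + (Ad D)^T *m q.

Definition r_breve (R : realType) (D : pmsm R) (P : 'M[R]_2) (q : 'cV[R]_2)
    (r : R) p (u : 'I_p -> 'cV[R]_2) (i : 'I_p) (theta : R) : R :=
  normP2 P (h_ D u i theta) + 2 * dotv q (h_ D u i theta) + r.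

Definition Vhat_plus (R : realType) (D : pmsm R) (P : 'M[R]_2) (q : 'cV[R]_2)
    (r : R) p (u : 'I_p -> 'cV[R]_2) (i : 'I_p) (xi : 'cV[R]_2) (theta : R)
    : R :=
  normP2 (P_breve D P) xi + 2 * dotv (q_breve D P q u i theta) xi
    + r_breve D P q r u i theta.

Definition Omega (R : realType) (P : 'M[R]_2) (q : 'cV[R]_2) (r delta : R) :
  set 'cV[R]_2 := [set xi | Vhat P q r xi <= delta].

Definition sigma_i (R : realType) (D : pmsm R) (P : 'M[R]_2) (q : 'cV[R]_2)
    (r delta : R) p (u : 'I_p -> 'cV[R]_2) (i : 'I_p) (theta : R) : \bar R :=
  emax [set (Vhat_plus D P q r u i xi theta)%:E
         | xi in region D P q u i theta `&` Omega P q r delta].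

Definition sigma (R : realType) (D : pmsm R) (P : 'M[R]_2) (q : 'cV[R]_2)
    (r delta : R) p (u : 'I_p -> 'cV[R]_2) (theta : R) : \bar R :=
  emax [set sigma_i D P q r delta u i theta | i in [set: 'I_p]].

Definition angles (R : realType) : set R := [set theta | 0 <= theta < 2 * pi].

(* Main.v *)
(* Under the input u_i, Vhat after one step is the quadratic Vhat_plus i, and
   the half-planes cutting out region i say exactly that Vhat_plus i is minimal
   among all Vhat_plus j (the term in P_breve cancels in the differences). Since
   gamma > 0 and the stage cost does not depend on u, the MPC therefore picks an
   index i whose region contains xi, so for xi in Omega the value of Vhat at the
   next step is one of the values over which sigma_i is maximized. *)
Require Import Defs.
From mathcomp Require Import ring.

Set Implicit Arguments.
Unset Strict Implicit.
Unset Printing Implicit Defensive.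

Local Open Scope classical_set_scope.
Local Open Scope ring_scope.

Section DotProduct.
Variables (R : realType) (n : nat).
Implicit Types x y z : 'cV[R]_n.

Lemma dotvC x y : dotv x y = dotv y x.
Proof.
by rewrite /dotv -[y in LHS]trmxK -trmx_mul mxE.
Qed.

Lemma dotvDl x y z : dotv (x + y) z = dotv x z + dotv y z.
Proof. by rewrite /dotv linearD /= mulmxDl mxE. Qed.

Lemma dotvDr x y z : dotv x (y + z) = dotv x y + dotv x z.
Proof. by rewrite dotvC dotvDl !(dotvC x). Qed.

Lemma dotvZl (c : R) x y : dotv (c *: x) y = c * dotv x y.
Proof. by rewrite /dotv linearZ /= -scalemxAl mxE. Qed.

Lemma dotvNl x y : dotv (- x) y = - dotv x y.
Proof. by rewrite -scaleN1r dotvZl mulN1r. Qed.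

Lemma dotv_trmx_mul m (M : 'M[R]_(m, n)) (x : 'cV[R]_m) y :
  dotv (M^T *m x) y = dotv x (M *m y).
Proof. by rewrite /dotv trmx_mul trmxK mulmxA. Qed.

Lemma normP2E (P : 'M[R]_n) x : normP2 P x = dotv x (P *m x).
Proof. by rewrite /normP2 /dotv mulmxA. Qed.

(** Symmetry of [P] makes the two cross terms equal; they are written with [P *m y] on the left to
    match the shape of [q_breve]. *)
Lemma normP2D (P : 'M[R]_n) x y : P^T = P ->
  normP2 P (x + y) = normP2 P x + 2 * dotv (P *m y) x + normP2 P y.
Proof.
move=> Psym; rewrite !normP2E mulmxDr !(dotvDl, dotvDr).
have -> : dotv x (P *m y) = dotv (P *m y) x by exact: dotvC.
have -> : dotv y (P *m x) = dotv (P *m y) x by rewrite -dotv_trmx_mul Psym.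
ring.
Qed.

End DotProduct.

Section ClosedLoop.
Variables (R : realType) (D : pmsm R) (p : nat) (u : 'I_p -> 'cV[R]_2).
Variables (P : 'M[R]_2) (q : 'cV[R]_2) (r : R).
Implicit Types (i j : 'I_p) (xi : 'cV[R]_2) (theta : R).

Lemma Vhat_err_dyn i xi theta : P^T = P ->
  Vhat P q r (err_dyn D xi theta (u i)) = Vhat_plus D P q r u i xi theta.
Proof.
move=> Psym.
have -> : err_dyn D xi theta (u i) = Ad D *m xi + h_ D u i theta.
  by rewrite /err_dyn -addrA.
rewrite /Vhat /Vhat_plus /q_breve /r_breve (normP2D _ _ Psym).
have -> : normP2 (P_breve D P) xi = normP2 P (Ad D *m xi).
  by rewrite /normP2 /P_breve trmx_mul !mulmxA.
rewrite dotvDl dotvDr -mulmxA !dotv_trmx_mul; ring.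
Qed.

(** Besides the [P_breve] term, [r] and the term in [(Ad D)^T *m q] cancel, which leaves a function
    affine in [xi]. *)
Lemma Vhat_plusB i j xi theta :
  Vhat_plus D P q r u i xi theta - Vhat_plus D P q r u j xi theta =
  dotv (a_ D P u i j theta) xi + b_ D P q u i j theta.
Proof.
rewrite /Vhat_plus /q_breve /r_breve /a_ /b_ /htilde.
move: (h_ D u i theta) (h_ D u j theta) => hi hj.
(* The products with [q] are flipped so that the difference splits on the left, then flipped back so
   that [ring] sees equal atoms. *)
rewrite mulmxBr dotvZl (dotvC q (_ - _)) !dotvDl !dotvNl !(dotvC _ q); ring.
Qed.

(** Any [r] may be taken here: it shifts both sides of each comparison equally and leaves no trace
    in [region]. *)
Lemma regionE i theta : region D P q u i theta =
  [set xi | forall j, Vhat_plus D P q r u i xi theta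
                      <= Vhat_plus D P q r u j xi theta].
Proof.
have halfplaneE xi j : (dotv (a_ D P u i j theta) xi <= - b_ D P q u i j theta)
    = (Vhat_plus D P q r u i xi theta <= Vhat_plus D P q r u j xi theta).
  by rewrite -[RHS]subr_le0 Vhat_plusB -[LHS]subr_le0 opprK.
(* The two inclusions need [halfplaneE] in opposite directions. *)
by apply/seteqP; split=> xi /= le_i j; rewrite (halfplaneE, =^~ halfplaneE).
Qed.

(** A supremum bounds its set from above, attained or not; this is used over [xi], then over [i]. *)
Lemma Vhat_plus_le_sigma delta i xi theta :
  region D P q u i theta xi -> Omega P q r delta xi ->
  ((Vhat_plus D P q r u i xi theta)%:E <= sigma D P q r delta u theta)%E.
Proof.
move=> xi_region xi_Omega.
apply: (@le_trans _ _ (sigma_i D P q r delta u i theta)).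
- by apply: ereal_sup_ubound; exists xi.
- by apply: ereal_sup_ubound; exists i.
Qed.

End ClosedLoop.

Theorem proposition2 (R : realType) (D : pmsm R)
  (Ld_gt0 : 0 < Ld D) (Lq_gt0 : 0 < Lq D) (Ts_gt0 : 0 < Ts D)
  (Vbus_gt0 : 0 < Vbus D) (Nlevel_ge2 : (2 <= Nlevel D)%N)
  (gamma : R) (gamma_gt0 : 0 < gamma) (gamma_lt1 : gamma < 1)
  (p : nat) (u : 'I_p -> 'cV[R]_2) (u_enum : enumerates (control_set D) u)
  (P : 'M[R]_2) (P_posdef : sym_posdef P) (q : 'cV[R]_2) (r : R)
  (k : 'cV[R]_2 -> R -> 'cV[R]_2)
  (k_mpc : horizon_one_mpc D gamma (Vhat P q r) k)
  (delta : R) (delta_gt0 : 0 < delta)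
  (sigma_le : (emax [set sigma D P q r delta u theta | theta in @angles R]
                 <= delta%:E)%E) :
  forall (xi : 'cV[R]_2) (theta : R),
    Omega P q r delta xi -> angles theta ->
    Vhat P q r (err_dyn D xi theta (k xi theta)) <= delta.
Proof.
move=> xi theta xi_Omega theta_angle.
have [Psym _] := P_posdef; have [_ range_u] := u_enum.
have [+ k_min] := k_mpc xi theta.
(* The enumeration gives an index [i] to the chosen input, however ties were broken. *)
rewrite -{1}range_u => -[i _ kE].
rewrite -kE Vhat_err_dyn // -lee_fin.
apply: le_trans sigma_le.
apply: (@le_trans _ _ (sigma D P q r delta u theta)); last first.
  by apply: ereal_sup_ubound; exists theta.
apply: Vhat_plus_le_sigma => //; rewrite (regionE _ _ _ _ r) => j.
have /k_min : control_set D (u j) by rewrite -range_u; exists j.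
by rewrite -kE lerD2l ler_pM2l // !Vhat_err_dyn.
Qed.
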